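(* The function $K^*$ possesses a distribution function relative to the set of natural numbers: there exists a distribution function $D:\mathbb{R}\to[0,1]$ (nondecreasing, right-continuous, with $\lim_{u\to-\infty}D(u)=0$ and $\lim_{u\to\infty}D(u)=1$) such that at every point $u$ of continuity of $D$, \[ D(u)=\lim_{x\to\infty}\frac1x\#\{N\le x : K^*(N)\le u\}. \]
   Context: Throughout, $p$ denotes a prime. For a positive integer $N$, $\nu_p(N)$ is the exponent of $p$ in $N$, $\phi$ is Euler's totient function, and $\left(\frac{N-1}{p}\right)^2$ equals $0$ if $p\mid N-1$ and $1$ otherwise. Define \[ K(N) = \prod_{p\nmid N}\bigg(1-\frac{\left(\frac{N-1}{p}\right)^2 p+1}{(p-1)^2(p+1)}\bigg)\prod_{p\mid N}\bigg(1-\frac{1}{p^{\nu_p(N)}(p-1)}\bigg), \qquad K^*(N)=K(N)\frac{N}{\phi(N)}. \] *)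

(* Defs.v *)
From mathcomp Require Import all_boot all_order all_algebra.
From mathcomp Require Import all_classical all_reals all_analysis.
Set Implicit Arguments.
Unset Strict Implicit.
Unset Printing Implicit Defensive.
Import Order.TTheory GRing.Theory Num.Theory.
Import numFieldNormedType.Exports.
Local Open Scope classical_set_scope.
Local Open Scope ring_scope.

(* ((N - 1) / p) ^ 2, for N >= 1 *)
Definition legendre_sq (R : realType) (N p : nat) : R :=
  if (p %| N.-1)%N then 0 else 1.

(* Limit of the partial products over primes p < n; all the factors lie in
   [0, 1], so it exists for every N. *)
Definition K_coprime (R : realType) (N : nat) : R :=
  limn (fun n : nat => \prod_(0 <= p < n | prime p && ~~ (p %| N)%N)
    (1 - (legendre_sq R N p * p%:R + 1) / ((p%:R - 1) ^+ 2 * (p%:R + 1)))).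

Definition K_dividing (R : realType) (N : nat) : R :=
  \prod_(p <- primes N) (1 - (p%:R ^+ logn p N * (p%:R - 1))^-1).

Definition K (R : realType) (N : nat) : R := K_coprime R N * K_dividing R N.

Definition Kstar (R : realType) (N : nat) : R :=
  K R N * (N%:R / (totient N)%:R).

Definition is_distribution_function (R : realType) (D : R -> R) : Prop :=
  [/\ forall u, 0 <= D u <= 1,
      {homo D : u v / u <= v},
      right_continuous D,
      D u @[u --> -oo] --> (0 : R)
    & D u @[u --> +oo] --> (1 : R)].

(* D is a distribution function of f relative to the positive integers;
   x tends to infinity through the reals. *)
Definition has_distribution_function (R : realType) (f : nat -> R)
    (D : R -> R) : Prop :=
  is_distribution_function D /\
  forall u : R, {for u, continuous D} ->
    x^-1 * (count (fun N => f N <= u) (iota 1 (Num.truncn x)))%:R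
      @[x --> +oo] --> D u.

(* Main.v *)
(* Kstar N = K N / (totient N / N), and both K and the totient ratio are limits
   in mean of functions of N depending only on N modulo some q:
   truncate the products over primes to p < y and replace N by N mod p^k in each
   factor.  The factors of K are within 1 / (p - 1)^2 of 1, and the totient ratio
   differs from its truncation by at most the sum of 1 / d over the divisors
   d >= y of N, whose mean over N is at most 1 / (y - 1).  Functions that are
   approximable in mean by periodic ones (Besicovitch almost periodic) have mean
   values and are stable under Lipschitz maps.  As the totient ratio is bounded
   below off a set of small density, t (Kstar N) therefore has a mean value for
   every piecewise linear cutoff t, so that the upper and lower distribution
   functions of Kstar agree up to an arbitrarily small shift of the argument. *)
Require Import Defs.
From mathcomp Require Import all_boot all_order all_algebra.
From mathcomp Require Import all_classical all_reals all_analysis.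
From mathcomp Require Import ring lra.
Set Implicit Arguments.
Unset Strict Implicit.
Unset Printing Implicit Defensive.
Import Order.TTheory GRing.Theory Num.Theory.
Import numFieldNormedType.Exports.
Local Open Scope classical_set_scope.
Local Open Scope ring_scope.

(** * Almost periodic functions in mean *)

(** This forces the upper limit of the averages of [h] to be at most [e] without forming a limit.
    Sums start at 1, so the value at 0 never matters. *)
Definition mean_le (R : realType) (h : nat -> R) (e : R) :=
  exists C, forall n, \sum_(1 <= N < n.+1) h N <= e * n%:R + C.

(** The approximants are genuinely periodic functions rather than trigonometric polynomials, so a
    map can be applied to them pointwise without losing periodicity. *)
Definition almost_periodic (R : realType) (h : nat -> R) :=
  forall e, 0 < e -> exists q g, [/\ (0 < q)%N,
    forall N, g (N + q)%N = g N & mean_le (fun N => `|h N - g N|) e].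

Section AlmostPeriodic.
Variable R : realType.
Implicit Types (h g : nat -> R) (e : R).

Lemma mean_le_le h g e e' :
  (forall N, (0 < N)%N -> h N <= g N) -> e <= e' -> mean_le g e -> mean_le h e'.
Proof.
move=> hg ee' [C gC]; exists C => n.
apply: (@le_trans _ _ (\sum_(1 <= N < n.+1) g N)).
  rewrite big_nat_cond [leRHS]big_nat_cond.
  by apply: ler_sum => N /andP[/andP[? _] _]; exact: hg.
by apply: le_trans (gC n) _; rewrite lerD2r ler_wpM2r.
Qed.

Lemma mean_leD h g e e' :
  mean_le h e -> mean_le g e' -> mean_le (fun N => h N + g N) (e + e').
Proof.
move=> [C hC] [C' gC]; exists (C + C') => n.
rewrite big_split /=; have := hC n; have := gC n; lra.
Qed.

Lemma mean_leZ h e a : 0 <= a -> mean_le h e -> mean_le (fun N => a * h N) (a * e).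
Proof.
move=> a0 [C hC]; exists (a * C) => n.
by rewrite -mulr_sumr -mulrA -mulrDr ler_wpM2l.
Qed.

Lemma periodicM (T : Type) (g : nat -> T) q k N :
  (forall N, g (N + q)%N = g N) -> g (N + k * q)%N = g N.
Proof.
move=> gq; elim: k => [|k IH]; first by rewrite mul0n addn0.
by rewrite mulSn (addnC q) addnA gq.
Qed.

Lemma periodic_modn (T : Type) (g : nat -> T) q N :
  (forall N, g (N + q)%N = g N) -> g N = g (N %% q)%N.
Proof. by move=> gq; rewrite {1}(divn_eq N q) addnC periodicM. Qed.

Lemma almost_periodic_periodic g q :
  (0 < q)%N -> (forall N, g (N + q)%N = g N) -> almost_periodic g.
Proof.
move=> q0 gq e e0; exists q, g; split=> //; exists 0 => n.
by rewrite big1 ?addr0 ?mulr_ge0 ?ler0n // ?ltW// => i _; rewrite subrr normr0.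
Qed.

Lemma almost_periodic_closed h :
  (forall e, 0 < e -> exists g, almost_periodic g /\ mean_le (fun N => `|h N - g N|) e) ->
  almost_periodic h.
Proof.
move=> H e e0; have e20 : 0 < e / 2 by lra.
have [g [/(_ _ e20)[q [k [q0 kq gk]]] hg]] := H _ e20.
exists q, k; split=> //; apply: mean_le_le (mean_leD hg gk) => [N _|]; last by lra.
by rewrite (le_trans _ (ler_normD _ _))// addrA subrK.
Qed.

Lemma almost_periodic_lipschitz2 (F : R -> R -> R) L h g : 0 < L ->
  (forall a b a' b', `|F a b - F a' b'| <= L * (`|a - a'| + `|b - b'|)) ->
  almost_periodic h -> almost_periodic g ->
  almost_periodic (fun N => F (h N) (g N)).
Proof.
move=> L0 FL ah ag e e0.
have eL : 0 < e / (2 * L) by rewrite divr_gt0// mulr_gt0.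
have [q [h' [q0 h'q hh']]] := ah _ eL; have [r [g' [r0 g'r gg']]] := ag _ eL.
exists (q * r)%N, (fun N => F (h' N) (g' N)); split.
- by rewrite muln_gt0 q0.
- by move=> N; rewrite (periodicM _ _ g'r) mulnC (periodicM _ _ h'q).
have := mean_leZ (ltW L0) (mean_leD hh' gg').
by apply: mean_le_le => // ; rewrite le_eqVlt; apply/orP; left; apply/eqP; field; lra.
Qed.

(** The discrepancy [S n] between the partial sum and its linear term is itself periodic of period
    [q], hence bounded by the sum of its absolute values over one period. *)
Lemma periodic_mean g q : (0 < q)%N -> (forall N, g (N + q)%N = g N) ->
  exists mu C, forall n, `|\sum_(1 <= N < n.+1) g N - mu * n%:R| <= C.
Proof.
move=> q0 gq; pose mu := (\sum_(1 <= N < q.+1) g N) / q%:R.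
pose S n := \sum_(1 <= N < n.+1) g N - mu * n%:R.
have SS n : S n.+1 = S n + (g n.+1 - mu).
  by rewrite /S big_nat_recr//= -natr1; ring.
have Sq N : S (N + q)%N = S N.
  elim: N => [|N IH]; last by rewrite addSn !SS IH -addSn gq.
  rewrite add0n /S big_nil /mu mulfVK ?subrr ?mulr0 ?subr0//.
  by rewrite pnatr_eq0 -lt0n.
exists mu, (\sum_(i < q) `|S i|) => n.
rewrite -/(S n) (periodic_modn n Sq) (bigD1 (Ordinal (ltn_pmod n q0)))//=.
by rewrite lerDl sumr_ge0.
Qed.

(** Here [mu] may depend on [e]: an approximate mean value for each [e] suffices for comparing
    frequencies. *)
Lemma almost_periodic_mean h e : almost_periodic h -> 0 < e ->
  exists mu C, forall n, `|\sum_(1 <= N < n.+1) h N - mu * n%:R| <= e * n%:R + C.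
Proof.
move=> ah e0; have [q [g [q0 gq [C hC]]]] := ah _ e0.
have [mu [C' gC]] := periodic_mean q0 gq.
exists mu, (C + C') => n.
have -> : \sum_(1 <= N < n.+1) h N - mu * n%:R =
  \sum_(1 <= N < n.+1) (h N - g N) + (\sum_(1 <= N < n.+1) g N - mu * n%:R).
  by rewrite sumrB; ring.
rewrite (le_trans (ler_normD _ _))// addrA lerD//.
by rewrite (le_trans (ler_norm_sum _ _ _)).
Qed.

Lemma count_multiples d n : (0 < d)%N ->
  \sum_(1 <= N < n.+1) (d %| N)%N%:R <= n%:R / d%:R :> R.
Proof.
move=> d0; suff -> : \sum_(1 <= N < n.+1) (d %| N)%N%:R = (n %/ d)%:R :> R.
  by rewrite ler_pdivlMr ?ltr0n// -natrM ler_nat leq_divM.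
elim: n => [|n IH]; first by rewrite big_nil div0n.
by rewrite big_nat_recr//= IH divnS// natrD addrC.
Qed.

Lemma mean_le_multiples d : (0 < d)%N ->
  mean_le (fun N => (d %| N)%N%:R : R) d%:R^-1.
Proof.
by move=> d0; exists 0 => n; rewrite addr0 mulrC; exact: count_multiples.
Qed.

Lemma almost_periodic_residue h :
  (forall N, (0 < N)%N -> 0 <= h N <= 1) ->
  (forall e, 0 < e -> exists q, [/\ (0 < q)%N, q%:R^-1 <= e &
     forall N, (0 < N)%N -> ~~ (q %| N)%N -> h N = h (N %% q)%N]) ->
  almost_periodic h.
Proof.
move=> h01 H e e0; have [q [q0 qe hq]] := H _ e0.
(* The approximant differs from [h] only on multiples of [q], by at most 1, and these have density
   [q^-1]. *)
exists q, (fun N => if (q %| N)%N then 0 else h (N %% q)%N); split=> //.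
  by move=> N; rewrite dvdn_addl// modnDr.
apply: mean_le_le (mean_le_multiples q0) => // N N0.
case: ifPn => qN; last by rewrite -hq// subrr normr0.
by rewrite subr0 ger0_norm; have /andP[] := h01 N N0.
Qed.

(** Truncation to the unit interval turns multiplication, and later division, into globally
    Lipschitz maps, as [almost_periodic_lipschitz2] demands. *)
Definition clamp (a : R) := if a <= 0 then 0 else if 1 <= a then 1 else a.

Lemma clamp_itv a : 0 <= clamp a <= 1.
Proof. by rewrite /clamp; case: ifPn => ?; [|case: ifPn => ?]; apply/andP; split; lra. Qed.

Lemma clamp_id a : 0 <= a <= 1 -> clamp a = a.
Proof. by rewrite /clamp => /andP[? ?]; case: ifPn => ?; [|case: ifPn => ?]; lra. Qed.

Lemma clamp_lipschitz a b : `|clamp a - clamp b| <= `|a - b|.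
Proof.
wlog ab : a b / a <= b => [H|].
  have [|/ltW ba] := leP a b; first exact: H.
  by rewrite distrC (distrC a); exact: H.
rewrite (distrC a) (distrC (clamp a)) [leRHS]ger0_norm ?subr_ge0// /clamp.
by do ![case: ifPn => ?]; rewrite ger0_norm; lra.
Qed.

Lemma dist_mul (a b a' b' : R) : 0 <= a' <= 1 -> 0 <= b <= 1 ->
  `|a * b - a' * b'| <= `|a - a'| + `|b - b'|.
Proof.
move=> /andP[a0 a1] /andP[b0 b1].
have -> : a * b - a' * b' = (a - a') * b + a' * (b - b') by ring.
rewrite (le_trans (ler_normD _ _))// !normrM (ger0_norm a0) (ger0_norm b0) lerD//.
  by rewrite ler_piMr.
by rewrite ler_piMl.
Qed.

Lemma almost_periodicM h g :
  (forall N, 0 <= h N <= 1) -> (forall N, 0 <= g N <= 1) ->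
  almost_periodic h -> almost_periodic g -> almost_periodic (fun N => h N * g N).
Proof.
move=> h01 g01 ah ag.
have -> : (fun N => h N * g N) = (fun N => clamp (h N) * clamp (g N)).
  by apply/funext => N; rewrite !clamp_id.
apply: (@almost_periodic_lipschitz2 (fun a b => clamp a * clamp b) 1) => // a b a' b'.
by rewrite mul1r (le_trans (dist_mul _ _ _ _)) ?clamp_itv// lerD ?clamp_lipschitz.
Qed.

Lemma almost_periodic_prod (I : Type) (s : seq I) (P : pred I) (c : I -> nat -> R) :
  (forall i N, P i -> 0 <= c i N <= 1) -> (forall i, P i -> almost_periodic (c i)) ->
  almost_periodic (fun N => \prod_(i <- s | P i) c i N).
Proof.
move=> c01 ac; elim: s => [|i s IH].
  by apply: (@almost_periodic_periodic _ 1) => // N; rewrite !big_nil.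
have [Pi|nPi] := boolP (P i); last first.
  by under eq_fun do rewrite big_cons (negbTE nPi).
under eq_fun do rewrite big_cons Pi.
 apply: almost_periodicM => //; first by move=> N; exact: c01.
  move=> N; apply/andP; split; first by apply: prodr_ge0 => j /(c01 j N)/andP[].
  by apply: prodr_ile1 => j /(c01 j N).
exact: ac.
Qed.

End AlmostPeriodic.

(** * Limiting distributions *)

Section LimitingDistribution.
Variable R : realType.
Implicit Types (u v t e : R).

Definition ramp u v t : R := clamp ((v - t) / (v - u)).

Lemma ramp_ge u v t : u < v -> (t <= u)%R%:R <= ramp u v t.
Proof.
move=> uv; have /andP[r0 r1] := clamp_itv ((v - t) / (v - u)).
case: (lerP t u) => // tu; have : 1 <= (v - t) / (v - u).
  by rewrite ler_pdivlMr; lra.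
by rewrite /ramp /clamp; do ![case: ifPn => ?]; rewrite ?lexx /=; lra.
Qed.

Lemma ramp_le u v t : u < v -> ramp u v t <= (t <= v)%R%:R.
Proof.
move=> uv; have /andP[r0 r1] := clamp_itv ((v - t) / (v - u)).
case: (lerP t v) => // vt; rewrite /ramp /clamp ifT// ler_pdivrMr; lra.
Qed.

Lemma ramp_lipschitz u v t t' : u < v ->
  `|ramp u v t - ramp u v t'| <= (v - u)^-1 * `|t - t'|.
Proof.
move=> uv; rewrite (le_trans (clamp_lipschitz _ _))//.
have -> : (v - t) / (v - u) - (v - t') / (v - u) = (v - u)^-1 * (t' - t).
  by field; lra.
by rewrite normrM distrC gtr0_norm// invr_gt0; lra.
Qed.

Variable f : nat -> R.

Definition freq n u : R := n%:R^-1 * (count (fun N => f N <= u) (iota 1 n))%:R.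

Lemma freqE n u : freq n u = n%:R^-1 * \sum_(1 <= N < n.+1) (f N <= u)%R%:R.
Proof.
congr (_ * _); rewrite /index_iota subSS subn0.
by elim: (iota 1 n) => [|i s IH]; rewrite ?big_nil// big_cons -IH /= natrD.
Qed.

Lemma freq_itv n u : 0 <= freq n u <= 1.
Proof.
rewrite mulr_ge0//= ?invr_ge0// /freq; case: n => [|n]; first by rewrite mulr0.
rewrite mulrC ler_pdivrMr ?ltr0n// mul1r ler_nat.
by rewrite (leq_trans (count_size _ _))// size_iota.
Qed.

Lemma freq_mono n u v : u <= v -> freq n u <= freq n v.
Proof.
move=> uv; rewrite ler_wpM2l ?invr_ge0// ler_nat sub_count// => N /= Nu.
exact: le_trans uv.
Qed.

(* The right limit at u of the upper distribution function of f. *)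
Definition limdist u : R := inf [set c | exists2 v, u < v &
  exists n0, forall n, (n0 <= n)%N -> freq n v <= c].

Let limdist_le u v c n0 : u < v -> (forall n, (n0 <= n)%N -> freq n v <= c) ->
  limdist u <= c.
Proof.
move=> uv H; apply: ge_inf; last by exists v => //; exists n0.
exists 0 => x [w _ [n1 H1]]; apply: le_trans (H1 n1 _) => //.
by have /andP[] := freq_itv n1 w.
Qed.

Let le_limdist u c : (forall c' v n0, u < v ->
    (forall n, (n0 <= n)%N -> freq n v <= c') -> c <= c') -> c <= limdist u.
Proof.
move=> H; apply: lb_le_inf; last by move=> x [v uv [n0 n0P]]; exact: H uv n0P.
exists 1, (u + 1); first by lra.
by exists 0%N => n _; have /andP[] := freq_itv n (u + 1).
Qed.

Let limdist_lt u e : 0 < e -> exists c v n0,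
  [/\ u < v, forall n, (n0 <= n)%N -> freq n v <= c & c < limdist u + e].
Proof.
move=> e0; apply/not_existsP => H.
suff : limdist u + e <= limdist u by lra.
apply: le_limdist => c v n0 uv n0P; rewrite leNgt; apply/negP => ce.
by apply: (H c); exists v, n0.
Qed.

Lemma limdist_mono : {homo limdist : u v / u <= v}.
Proof.
move=> u v uv; apply: le_limdist => c w n0 vw; apply: limdist_le; lra.
Qed.

Lemma limdist_itv u : 0 <= limdist u <= 1.
Proof.
apply/andP; split.
  apply: le_limdist => c v n0 _ /(_ n0 (leqnn _)); apply: le_trans.
  by have /andP[] := freq_itv n0 v.
apply: (@limdist_le u (u + 1) 1 0); first lra.
by move=> n _; have /andP[] := freq_itv n (u + 1).
Qed.

Lemma limdist_right_continuous : right_continuous limdist.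
Proof.
move=> u; apply/cvgrPdist_le => e e0.
have [c [v [n0 [uv n0P ce]]]] := limdist_lt u e0.
near=> w.
have uw : u < w by near: w; exact: nbhs_right_gt.
have wv : w < v by near: w; exact: nbhs_right_lt.
have := limdist_mono (ltW uw); have := limdist_le wv n0P.
by rewrite ler_norml => ? ?; apply/andP; split; lra.
Unshelve. all: by end_near. Qed.

Lemma freq_le_limdist u e : 0 < e ->
  exists n0, forall n, (n0 <= n)%N -> freq n u <= limdist u + e.
Proof.
move=> e0; have [c [v [n0 [uv n0P ce]]]] := limdist_lt u e0.
exists n0 => n /n0P; have := freq_mono n (ltW uv); lra.
Qed.

Hypothesis ramp_ap : forall u v, u < v -> almost_periodic (fun N => ramp u v (f N)).

(* Both frequencies are compared with the mean value of the ramp. *)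
Lemma freq_asymp_mono u v e : u < v -> 0 < e ->
  exists n0, forall m n, (n0 <= m)%N -> (n0 <= n)%N -> freq m u <= freq n v + e.
Proof.
move=> uv e0; have e4 : 0 < e / 4 by lra.
have [mu [C HC]] := almost_periodic_mean (ramp_ap uv) e4.
(* Beyond this index [C] is at most [e / 4 * n%:R], so the total error is at most [e / 2 * n%:R]. *)
pose n0 := (Num.truncn (4 * C / e)).+1.
have n0P n : (n0 <= n)%N ->
    `|\sum_(1 <= N < n.+1) ramp u v (f N) - mu * n%:R| <= e / 2 * n%:R.
  move=> n0n; apply: le_trans (HC n) _.
  have : C <= e / 4 * n%:R.
    have : 4 * C / e <= n%:R.
      by rewrite (le_trans (ltW (truncnS_gt _)))// ler_nat.
    by rewrite ler_pdivrMr//; lra.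
  lra.
have n00 n : (n0 <= n)%N -> 0 < n%:R :> R
  by rewrite ltr0n; exact: leq_trans.
exists n0 => m n n0m n0n.
apply: (@le_trans _ _ (mu + e / 2)).
  rewrite freqE mulrC ler_pdivrMr ?n00//.
  apply: (@le_trans _ _ (\sum_(1 <= N < m.+1) ramp u v (f N))).
    by apply: ler_sum => N _; exact: ramp_ge.
  by have := n0P m n0m; rewrite ler_norml => /andP[_]; lra.
suff : mu - e / 2 <= freq n v by lra.
rewrite freqE [leRHS]mulrC ler_pdivlMr ?n00//.
apply: (@le_trans _ _ (\sum_(1 <= N < n.+1) ramp u v (f N))).
  by have := n0P n n0n; rewrite ler_norml => /andP[+ _]; lra.
by apply: ler_sum => N _; exact: ramp_le.
Qed.

Lemma limdist_le_freq u v e : u < v -> 0 < e ->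
  exists n0, forall n, (n0 <= n)%N -> limdist u - e <= freq n v.
Proof.
(* The midpoint lies strictly right of [u], as the infimum defining [limdist u] requires, and leaves
   room for a ramp down to [v]. For fixed [n], [freq n v + e] then bounds all late frequencies at
   the midpoint. *)
move=> uv e0; have [n0 n0P] := @freq_asymp_mono ((u + v) / 2) v e ltac:(lra) e0.
exists n0 => n n0n; rewrite lerBlDr.
apply: (@limdist_le u ((u + v) / 2) _ n0); first lra.
by move=> m n0m; exact: n0P.
Qed.

Lemma freq_cvg u : {for u, continuous limdist} ->
  x^-1 * (count (fun N => f N <= u) (iota 1 (Num.truncn x)))%:R
    @[x --> +oo] --> limdist u.
Proof.
move=> cu; apply/cvgrPdist_le => e e0; have e3 : 0 < e / 3 by lra.
have [n1 n1P] := freq_le_limdist u e3.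
(* Continuity enters here: the lower bound for frequencies at [u] comes from a point [w] on its left
   where [limdist] has dropped by at most [e / 3]. *)
have [w wu wP] : exists2 w, w < u & limdist u - e / 3 <= limdist w.
  move: cu => /cvgrPdist_le /(_ _ e3) /nbhs_ballP[d /= d0 H].
  exists (u - d / 2); first lra.
  have : ball u d (u - d / 2) by rewrite /ball/= opprB addrC subrK gtr0_norm; lra.
  by move=> /H; rewrite ler_norml => /andP[]; lra.
have [n2 n2P] := limdist_le_freq wu e3.
near=> x.
have x1 : 1 <= x by near: x; apply: nbhs_pinfty_ge; exact: num_real.
have xe : 3 / e <= x by near: x; apply: nbhs_pinfty_ge; exact: num_real.
have nP n : n%:R <= x -> (n <= Num.truncn x)%N by rewrite truncn_ge_nat//; lra.
have /n1P : (n1 <= Num.truncn x)%N.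
  by apply: nP; near: x; apply: nbhs_pinfty_ge; exact: num_real.
have /n2P : (n2 <= Num.truncn x)%N.
  by apply: nP; near: x; apply: nbhs_pinfty_ge; exact: num_real.
have n1x := nP 1%N x1.
have /andP[] := freq_itv (Num.truncn x) u.
have /andP[] := truncn_itv (le_trans ler01 x1).
have : (count (fun N => f N <= u) (iota 1 (Num.truncn x)))%:R =
    (Num.truncn x)%:R * freq (Num.truncn x) u.
  by rewrite mulrA mulfV ?mul1r// pnatr_eq0 -lt0n.
move: (freq _ u) => F -> nx; rewrite -natr1 => xn F0 F1 Fl Fu.
have x0 : 0 < x by lra.
have FN : (Num.truncn x)%:R * F <= x * F by rewrite ler_wpM2r.
(* Replacing [x] by its truncation costs at most 1, since [F <= 1]; after division by [x >= 3 / e]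
   this is at most [e / 3]. *)
have FN' : x * F - 1 <= (Num.truncn x)%:R * F.
  have : 0 <= ((Num.truncn x)%:R + 1 - x) * F by rewrite mulr_ge0//; lra.
  lra.
have ex : 1 <= e / 3 * x by move: xe; rewrite ler_pdivrMr//; lra.
have l1 : x^-1 * ((Num.truncn x)%:R * F) <= F by rewrite mulrC ler_pdivrMr//; lra.
have l2 : F - e / 3 <= x^-1 * ((Num.truncn x)%:R * F).
  by rewrite [leRHS]mulrC ler_pdivlMr// mulrBl; lra.
rewrite ler_norml; apply/andP; split; lra.
Unshelve. all: by end_near. Qed.

Hypothesis f_ge0 : forall N, (0 < N)%N -> 0 <= f N.
Hypothesis f_tight : forall e, 0 < e -> exists T n0,
  forall n, (n0 <= n)%N -> 1 - e <= freq n T.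

(** Nonnegativity makes [limdist] vanish at negative arguments, and tightness gives the limit 1 at
    infinity. *)
Lemma exists_distribution_function :
  exists D, has_distribution_function f D.
Proof.
exists limdist; split; last exact: freq_cvg.
split; [exact: limdist_itv|exact: limdist_mono|exact: limdist_right_continuous| |].
- apply/cvgrPdist_le => e e0; near=> u.
  have u0 : u < 0 by near: u; apply: nbhs_ninfty_lt; exact: num_real.
  have -> : limdist u = 0.
    apply/eqP; rewrite eq_le; have /andP[-> _] := limdist_itv u; rewrite andbT.
    (* For negative [u], the point [u / 2] is to its right and still negative, so every frequency
       there is 0. *)
    apply: (@limdist_le u (u / 2) 0 0); first lra.
    move=> n _; rewrite freqE big1_seq ?mulr0// => N.
    rewrite mem_index_iota => /andP[_ /andP[N0 _]].
    by have := f_ge0 N0; case: (lerP (f N)) => //; lra.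
  by rewrite subrr normr0 ltW.
apply/cvgrPdist_le => e e0; have [T [n0 n0P]] := f_tight e0.
near=> u; have Tu : T <= u by near: u; apply: nbhs_pinfty_ge; exact: num_real.
have /andP[_ Du1] := limdist_itv u.
rewrite ger0_norm ?subr_ge0// lerBlDr -lerBlDl.
apply: le_limdist => c v n1 uv n1P.
apply: le_trans (n1P (maxn n0 n1) (leq_maxr _ _)).
by rewrite (le_trans (n0P _ (leq_maxl n0 n1)))// freq_mono//; lra.
Unshelve. all: by end_near. Qed.

End LimitingDistribution.

(** * The totient ratio *)

Section TailBounds.
Variable R : realType.

(** The Weierstrass product inequality, which bounds the tails of both Euler products from below. *)
Lemma prod_ge_1_sub_sum (I : Type) (s : seq I) (P : pred I) (F : I -> R) :
  (forall i, P i -> 0 <= F i <= 1) ->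
  1 - \sum_(i <- s | P i) (1 - F i) <= \prod_(i <- s | P i) F i.
Proof.
move=> F01; elim: s => [|i s IH]; first by rewrite !big_nil subr0.
rewrite !big_cons; case: ifPn => // Pi; have /andP[F0 F1] := F01 _ Pi.
apply: (@le_trans _ _ (F i * (1 - \sum_(j <- s | P j) (1 - F j)))).
  have : 0 <= \sum_(j <- s | P j) (1 - F j).
    by apply: sumr_ge0 => j /F01 /andP[_]; rewrite subr_ge0.
  move: (\sum_(j <- s | P j) _) => S S0.
  have : 0 <= (1 - F i) * S by rewrite mulr_ge0//; lra.
  lra.
by rewrite ler_wpM2l.
Qed.

Lemma sum_inv_sqr m n : \sum_(m.+2 <= d < n) (d%:R ^+ 2)^-1 <= m.+1%:R^-1 :> R.
Proof.
have [nm|mn] := leqP n m.+2; first by rewrite big_geq// invr_ge0.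
(* Telescoping of [1 / d^2 <= 1 / (d - 1) - 1 / d]; keeping the subtracted term makes the induction
   close. *)
suff : \sum_(m.+2 <= d < n) (d%:R ^+ 2)^-1 <= m.+1%:R^-1 - n.-1%:R^-1 :> R.
  by move=> /le_trans; apply; rewrite gerBl invr_ge0.
rewrite -(subnKC mn); elim: (n - m.+3)%N => [|j IH].
  rewrite addn0 big_nat1 /= -(@natr1 R m.+1).
  have : 0 < m.+1%:R :> R by rewrite ltr0n.
  move: (m.+1%:R) => x x0.
  have -> : x^-1 - (x + 1)^-1 = (x * (x + 1))^-1 by field; rewrite ?gt_eqF//=; lra.
  by rewrite lef_pV2 ?posrE ?mulr_gt0 ?exprn_gt0//; nra.
rewrite addnS big_nat_recr/=; last by rewrite ltnW// leq_addr.
apply: le_trans (lerD IH (lexx _)) _; rewrite (_ : (m.+3 + j)%N = (m + j).+3)//=.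
rewrite -(@natr1 R (m + j).+2).
have : 0 < (m + j).+2%:R :> R by rewrite ltr0n.
move: (_.+2%:R) => x x0.
have : ((x + 1) ^+ 2)^-1 <= x^-1 - (x + 1)^-1.
  have -> : x^-1 - (x + 1)^-1 = (x * (x + 1))^-1 by field; rewrite ?gt_eqF//=; lra.
  by rewrite lef_pV2 ?posrE ?mulr_gt0 ?exprn_gt0//; nra.
move: (_ ^- 2) (x^-1) ((x + 1)^-1) (m.+1%:R^-1) => a b c d; lra.
Qed.

(** The primes among these divisors control the tail of the totient product. Admitting all divisors
    still leaves a small mean, bounded by the tail of the sum of [1 / d^2]. *)
Definition large_divisor_sum y N : R := \sum_(y <= d < N.+1 | (d %| N)%N) d%:R^-1.

Lemma large_divisor_sum_ge0 y N : 0 <= large_divisor_sum y N.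
Proof. by apply: sumr_ge0 => d _; rewrite invr_ge0. Qed.

Lemma mean_large_divisor_sum m n :
  \sum_(1 <= N < n.+1) large_divisor_sum m.+2 N <= m.+1%:R^-1 * n%:R.
Proof.
(* Extending the range of [d] up to [n] makes it independent of [N], so the two sums can be
   exchanged and multiples of [d] counted. *)
apply: (@le_trans _ _ (\sum_(1 <= N < n.+1)
    \sum_(m.+2 <= d < n.+1) d%:R^-1 * (d %| N)%N%:R)).
  rewrite big_nat_cond [leRHS]big_nat_cond; apply: ler_sum => N /andP[/andP[_ Nn] _].
  rewrite /large_divisor_sum big_mkcond.
  have [NM|MN] := leqP N.+1 m.+2.
    by rewrite big_geq//; apply: sumr_ge0 => d _; rewrite mulr_ge0 ?invr_ge0.
  rewrite [leRHS](@big_cat_nat _ _ _ N.+1)//=; last exact: ltnW.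
  rewrite -[leLHS]addr0 lerD//; last first.
    by apply: sumr_ge0 => d _; rewrite mulr_ge0 ?invr_ge0.
  by apply: ler_sum => d _; case: ifPn; rewrite ?mulr1 ?mulr0.
rewrite exchange_big_nat/=.
apply: (@le_trans _ _ (\sum_(m.+2 <= d < n.+1) (d%:R ^+ 2)^-1 * n%:R)); last first.
  by rewrite -mulr_suml ler_wpM2r// sum_inv_sqr.
rewrite big_nat_cond [leRHS]big_nat_cond; apply: ler_sum => d /andP[/andP[md _] _].
have d0 : (0 < d)%N by exact: leq_trans md.
rewrite -mulr_sumr expr2 invfM -mulrA ler_wpM2l ?invr_ge0// [leRHS]mulrC.
exact: count_multiples.
Qed.

Lemma mean_le_large_divisor_sum m : mean_le (large_divisor_sum m.+2) m.+1%:R^-1.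
Proof. by exists 0 => n; rewrite addr0 mean_large_divisor_sum. Qed.

Lemma exists_inv_le (e : R) : 0 < e -> exists m : nat, m.+1%:R^-1 <= e.
Proof.
move=> e0; exists (Num.truncn e^-1).
by rewrite -[leRHS]invrK lef_pV2 ?posrE ?invr_gt0 ?ltr0n// ltW// truncnS_gt.
Qed.

Lemma prod_primes N n (F : nat -> R) : (0 < N < n)%N ->
  \prod_(0 <= p < n | prime p && (p %| N)%N) F p = \prod_(p <- primes N) F p.
Proof.
move=> /andP[N0 Nn]; rewrite -big_filter; apply: perm_big; apply: uniq_perm.
- by rewrite filter_uniq// iota_uniq.
- exact: primes_uniq.
move=> p; rewrite mem_filter mem_index_iota mem_primes N0/= -andbA.
case: (prime p) => //=; case: (boolP (p %| N)%N) => //= pN.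
by rewrite (leq_ltn_trans (dvdn_leq N0 pN) Nn).
Qed.

End TailBounds.

Section TotientRatio.
Variable R : realType.

Definition totient_factor N p : R := if (p %| N)%N then 1 - p%:R^-1 else 1.

Definition totient_ratio N : R := (totient N)%:R / N%:R.

Lemma totient_factor_itv N p : prime p -> 2^-1 <= totient_factor N p <= 1.
Proof.
move=> /prime_gt1 p1; rewrite /totient_factor.
have : p%:R^-1 <= 2^-1 :> R by rewrite lef_pV2 ?posrE ?ltr0n ?(ltnW p1)// ler_nat.
have : 0 <= p%:R^-1 :> R by rewrite invr_ge0.
by case: ifP => _ ? ?; apply/andP; split; lra.
Qed.

Lemma totient_factor_01 N p : prime p -> 0 <= totient_factor N p <= 1.
Proof. by move=> /(totient_factor_itv N)/andP[? ->]; rewrite andbT; lra. Qed.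

Lemma totient_ratioE N n : (0 < N < n)%N ->
  totient_ratio N = \prod_(0 <= p < n | prime p) totient_factor N p.
Proof.
move=> Nn; rewrite -big_mkcondr (prod_primes _ Nn).
have /andP[N0 _] := Nn.
have NE : N%:R = \prod_(p <- primes N) (p ^ logn p N)%:R :> R.
  by rewrite -natr_prod {1}(prod_prime_decomp N0) prime_decompE big_map.
rewrite /totient_ratio totientE// natr_prod NE -prodf_div; apply: eq_big_seq => p.
rewrite mem_primes N0/= => /andP[pp pN].
have l0 : (0 < logn p N)%N by rewrite logn_gt0 mem_primes pp N0.
have p0 := prime_gt0 pp; have p0' : p%:R != 0 :> R by rewrite pnatr_eq0 -lt0n.
(* One factor [p] is split off the denominator so that the remaining power cancels against the one
   in the totient. *)
rewrite -{2}(prednK l0) expnS !natrM invfM mulrACA mulfV ?mulr1.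
  by rewrite -subn1 natrB// mulrBl mulfV// mul1r.
by rewrite natrX expf_neq0.
Qed.

(* A crude bound: only its independence of N is needed. *)
Lemma prod_totient_factor_ge y N :
  (2 ^+ y)^-1 <= \prod_(0 <= p < y | prime p) totient_factor N p.
Proof.
rewrite big_mkcond; elim: y => [|y IH]; first by rewrite big_nil expr0 invr1.
rewrite big_nat_recr//= exprSr invfM ler_pM ?invr_ge0 ?exprn_ge0//.
case: ifPn => [/(totient_factor_itv N)/andP[]//|_]; lra.
Qed.

Lemma totient_ratio_split y N : (0 < N)%N -> exists T,
  [/\ 1 - large_divisor_sum R y N <= T, T <= 1 &
  totient_ratio N = (\prod_(0 <= p < y | prime p) totient_factor N p) * T].
Proof.
(* If [N < y], every prime divisor of [N] is below [y] and [T = 1]; otherwise [T] is the product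
   over primes from [y] to [N]. *)
move=> N0; have [Ny|yN] := leqP N.+1 y.
  by exists 1; rewrite mulr1 (@totient_ratioE _ y) ?N0// gerBl large_divisor_sum_ge0.
exists (\prod_(y <= p < N.+1 | prime p) totient_factor N p); split.
- apply: le_trans (prod_ge_1_sub_sum _ _); last by move=> p; exact: totient_factor_01.
  rewrite lerD2l lerN2 /large_divisor_sum big_mkcond [leRHS]big_mkcond.
  apply: ler_sum => p _; rewrite /totient_factor.
  case: (prime p); case: ifP => _; rewrite ?subrr ?invr_ge0//.
  by rewrite opprB addrC subrK.
- by apply: prodr_ile1 => p; exact: totient_factor_01.
by rewrite (@totient_ratioE _ N.+1) ?N0 ?ltnSn// (@big_cat_nat _ _ _ y)//= ltnW.
Qed.

Lemma totient_ratio_gt0 N : (0 < N)%N -> 0 < totient_ratio N.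
Proof. by move=> N0; rewrite divr_gt0 ?ltr0n ?totient_gt0. Qed.

(** The tail [T] is then at least 1/2. By the mean of [large_divisor_sum], the exceptional [N] have
    small density for large [y]. *)
Lemma totient_ratio_ge y N : (0 < N)%N -> large_divisor_sum R y N <= 2^-1 ->
  (2 ^+ y)^-1 / 2 <= totient_ratio N.
Proof.
move=> N0 S2; have [T [ST _ ->]] := totient_ratio_split y N0.
rewrite ler_pM ?invr_ge0 ?exprn_ge0 ?prod_totient_factor_ge//; lra.
Qed.

(** Each factor has period [p]. Writing the ratio as [Q * T], the truncation error is
    [Q * (1 - T) <= 1 - T], at most [large_divisor_sum]. *)
Lemma almost_periodic_totient_ratio : almost_periodic totient_ratio.
Proof.
apply: almost_periodic_closed => e /exists_inv_le[m me].
exists (fun N => \prod_(0 <= p < m.+2 | prime p) totient_factor N p); split.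
  apply: (@almost_periodic_prod _ _ _ _ (fun p N => totient_factor N p)) => [p N|p pp].
    exact: totient_factor_01.
  apply: (@almost_periodic_periodic _ _ p); first exact: prime_gt0.
  by move=> N; rewrite /totient_factor dvdn_addl.
apply: mean_le_le (mean_le_large_divisor_sum R m) => // N N0.
have [T [ST T1 ->]] := totient_ratio_split m.+2 N0.
have := prod_totient_factor_ge m.+2 N.
have : \prod_(0 <= p < m.+2 | prime p) totient_factor N p <= 1.
  by apply: prodr_ile1 => p; exact: totient_factor_01.
move: (\prod_(_ <= _ < _ | _) _) => Q Q1 Q0.
have Q0' : 0 <= Q by apply: le_trans Q0; rewrite invr_ge0 exprn_ge0.
rewrite -{2}(mulr1 Q) -mulrBr normrM (ger0_norm Q0') distrC ger0_norm ?subr_ge0//.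
apply: (@le_trans _ _ (1 - T)); last lra.
by rewrite ler_piMl// subr_ge0.
Qed.

End TotientRatio.

(** * The Euler product K *)

Section EulerProduct.
Variable R : realType.

(** Both kinds of primes share one factor, so that [K] becomes a limit of single products over all
    primes. *)
Definition K_factor N p : R :=
  if (p %| N)%N then 1 - (p%:R ^+ logn p N * (p%:R - 1))^-1
  else 1 - (legendre_sq R N p * p%:R + 1) / ((p%:R - 1) ^+ 2 * (p%:R + 1)).

(* Here logn p 0 = 0 is a junk value; only the bounds matter. *)
Lemma K_factor0_01 p : prime p -> 0 <= K_factor 0 p <= 1.
Proof.
move=> /prime_gt1 p1; rewrite /K_factor dvdn0 logn0 expr0 mul1r.
have : 2 <= p%:R :> R by rewrite ler_nat.
move: p%:R => x x2; have : (x - 1)^-1 <= 1 by rewrite invf_le1; lra.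
have : 0 <= (x - 1)^-1 by rewrite invr_ge0; lra.
by move=> ? ?; apply/andP; split; lra.
Qed.

(** If [p] divides [N], then [p ^ logn p N * (p - 1) >= (p - 1)^2]; otherwise the numerator is at
    most [p + 1], which cancels. *)
Lemma K_factor_near1 N p : (0 < N)%N -> prime p ->
  1 - ((p%:R - 1) ^+ 2)^-1 <= K_factor N p <= 1.
Proof.
move=> N0 pp; have p2 : 2 <= p%:R :> R by rewrite ler_nat prime_gt1.
rewrite /K_factor; case: ifPn => pN.
  have : p%:R <= p%:R ^+ logn p N :> R.
    rewrite -{1}(expr1 p%:R) ler_weXn2l//; first lra.
    by rewrite logn_gt0 mem_primes pp N0.
  move: p2; move: ((p%:R : R) ^+ logn p N) (p%:R : R) => y x x2 xy.
  rewrite gerBl invr_ge0 mulr_ge0 ?andbT; [|lra..].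
  rewrite lerD2l lerN2 lef_pV2 ?posrE ?mulr_gt0 ?exprn_gt0 ?expr2//; [|lra..].
  by rewrite ler_wpM2r; lra.
have : 0 <= legendre_sq R N p <= 1 by rewrite /legendre_sq; case: ifP; rewrite lexx ler01.
move: p2; move: (legendre_sq R N p) (p%:R) => l x x2 /andP[l0 l1].
have x1 : 0 < (x - 1) ^+ 2 by rewrite exprn_gt0; lra.
have lx0 : 0 <= l * x by rewrite mulr_ge0//; lra.
have lx1 : l * x <= x by rewrite ler_piMl//; lra.
have x3 : 0 < x + 1 by lra.
apply/andP; split; last by rewrite gerBl divr_ge0// ?mulr_ge0 ?ltW//; lra.
rewrite lerD2l lerN2 invfM mulrCA ger_pMr ?invr_gt0//.
by rewrite ler_pdivrMr; lra.
Qed.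

Lemma K_factor_01 N p : prime p -> 0 <= K_factor N p <= 1.
Proof.
move=> pp; have [->|N0] := posnP N; first exact: K_factor0_01.
have /andP[+ ->] := K_factor_near1 N0 pp; rewrite andbT; apply: le_trans.
have p2 : 2 <= p%:R :> R by rewrite ler_nat prime_gt1.
have p1 : 1 <= (p%:R - 1) ^+ 2 :> R by rewrite exprn_ege1//; lra.
by rewrite subr_ge0 invf_le1// (lt_le_trans ltr01).
Qed.

(** Reduction modulo [p ^ k] preserves divisibility by each [p ^ j] with [j <= k], and both
    exponents are below [k]. *)
Lemma logn_modn p k N : prime p -> (0 < N)%N -> ~~ (p ^ k %| N)%N ->
  logn p (N %% p ^ k) = logn p N.
Proof.
move=> pp N0 kN.
have M0 : (0 < N %% p ^ k)%N by rewrite lt0n.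
have kM : ~~ (p ^ k %| N %% p ^ k)%N by rewrite /dvdn modn_mod.
have dvdE d : (d %| p ^ k)%N -> (d %| N %% p ^ k)%N = (d %| N)%N.
  by move=> dk; rewrite /dvdn modn_dvdm.
move: kN kM; rewrite !pfactor_dvdn// -!ltnNge => kN kM.
apply/eqP; rewrite eqn_leq -!pfactor_dvdn//.
by rewrite -dvdE ?dvdn_exp2l ?pfactor_dvdnn//
  ?[in X in _ && X]dvdE ?dvdn_exp2l ?pfactor_dvdnn// ltnW.
Qed.

Lemma almost_periodic_K_factor p : prime p -> almost_periodic (K_factor ^~ p).
Proof.
move=> pp; apply: almost_periodic_residue => [N _|e e0]; first exact: K_factor_01.
have [m me] := exists_inv_le e0; exists (p ^ m.+1)%N; split.
- by rewrite expn_gt0 prime_gt0.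
- apply: le_trans me; rewrite lef_pV2 ?posrE ?ltr0n ?expn_gt0 ?(prime_gt0 pp)//.
  by rewrite ler_nat ltnW// ltn_expl ?prime_gt1.
move=> N N0 pN; have M0 : (0 < N %% p ^ m.+1)%N by rewrite lt0n.
have pm : (p %| p ^ m.+1)%N by rewrite expnS dvdn_mulr.
have pE : (p %| N %% p ^ m.+1)%N = (p %| N)%N by rewrite /dvdn modn_dvdm.
rewrite /K_factor logn_modn// pE; case: ifP => // _.
(* Divisibility of the predecessor is restated as congruence to 1 modulo [p], legitimate because [N]
   and its remainder are both positive. *)
by rewrite /legendre_sq -!subn1 -!eqn_mod_dvd// modn_dvdm.
Qed.

Definition K_partial n N : R := \prod_(0 <= p < n | prime p) K_factor N p.

Lemma K_partial_01 n N : 0 <= K_partial n N <= 1.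
Proof.
by rewrite prodr_ge0 ?prodr_ile1// => p /(K_factor_01 N)// /andP[].
Qed.

Lemma K_partial_cvg N : (0 < N)%N -> K_partial n N @[n --> \oo] --> K R N.
Proof.
move=> N0; pose Q n := \prod_(0 <= p < n | prime p && ~~ (p %| N)%N) K_factor N p.
have Q01 p : prime p && ~~ (p %| N)%N -> 0 <= K_factor N p <= 1.
  by move=> /andP[pp _]; exact: K_factor_01.
have Qge0 n : 0 <= Q n by apply: prodr_ge0 => p /Q01/andP[].
have Qcvg : cvgn Q.
  apply: nonincreasing_is_cvgn; last by exists 0 => _ [n _ <-].
  apply/nonincreasing_seqP => n; rewrite /Q big_mkcond [leRHS]big_mkcond big_nat_recr//=.
  rewrite -!big_mkcond/= -/(Q n) ler_piMr//.
  by case: ifP => // /Q01/andP[].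
have -> : K R N = limn Q * K_dividing R N.
  congr (_ * _); rewrite /K_coprime; congr (limn _); apply/funext => n.
  by apply: eq_bigr => p /andP[_ pN]; rewrite /K_factor (negbTE pN).
(* Once [n > N], the range contains every prime divisor of [N], so their share of the product is all
   of [K_dividing]. *)
have KQ : {near \oo, (fun n => Q n * K_dividing R N) =1 K_partial ^~ N}.
  exists N.+1 => // n /= Nn; rewrite /K_partial (bigID (fun p => p %| N)%N)/= mulrC.
  congr (_ * _); rewrite (prod_primes _ (_ : 0 < N < n)%N) ?N0//.
  rewrite /K_dividing; apply: eq_big_seq => p; rewrite mem_primes N0 => /and3P[_ _ pN].
  by rewrite /K_factor pN.
by apply: cvg_trans (near_eq_cvg KQ) _; apply: cvgMl.
Qed.

Lemma K_01 N : (0 < N)%N -> 0 <= K R N <= 1.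
Proof.
move=> /K_partial_cvg K_cvg; apply/andP; split.
  by apply: (cvgr_to_ge K_cvg); near=> n; have /andP[] := K_partial_01 n N.
by apply: (cvgr_to_le K_cvg); near=> n; have /andP[] := K_partial_01 n N.
Unshelve. all: by end_near. Qed.

Lemma K_partial_approx m N : (0 < N)%N -> `|K R N - K_partial m.+3 N| <= m.+1%:R^-1.
Proof.
move=> N0; have K_cvg := K_partial_cvg N0.
have /andP[P0 P1] := K_partial_01 m.+3 N.
have tail n : (m.+3 <= n)%N -> exists T,
    [/\ K_partial n N = K_partial m.+3 N * T, 1 - m.+1%:R^-1 <= T & T <= 1].
  move=> mn; exists (\prod_(m.+3 <= p < n | prime p) K_factor N p); split.
  - by rewrite /K_partial (@big_cat_nat _ _ _ m.+3).
  - apply: le_trans (prod_ge_1_sub_sum _ _); last by move=> p; exact: K_factor_01.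
    (* Shifting the index turns [1 / (p - 1)^2] for [p >= m + 3] into [1 / d^2] for [d >= m + 2],
       whence the [m.+3]; the bound is uniform in [N]. *)
    rewrite lerD2l lerN2; apply: le_trans (sum_inv_sqr R m n.-1).
    rewrite big_add1 big_mkcond; apply: ler_sum => p _.
    case: ifP => [/(K_factor_near1 N0)/andP[+ _]|_]; last by rewrite invr_ge0 exprn_ge0.
    by rewrite -natr1 addrK; lra.
  by apply: prodr_ile1 => p; exact: K_factor_01.
rewrite ler_norml; apply/andP; split.
  rewrite lerBrDr addrC; apply: (cvgr_to_ge K_cvg); exists m.+3 => // n /=.
  move=> /tail[T [-> Tm _]].
  have : 0 <= m.+1%:R^-1 :> R by rewrite invr_ge0.
  move: Tm P0 P1; move: (K_partial _ _) (_^-1) => a b; nra.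
rewrite lerBlDr; apply: (cvgr_to_le K_cvg); exists m.+3 => // n /= /tail[T [-> _ T1]].
have : 0 <= m.+1%:R^-1 :> R by rewrite invr_ge0.
move: T1 P0 P1; move: (K_partial _ _) (_^-1) => a b; nra.
Qed.

Lemma almost_periodic_K : almost_periodic (K R).
Proof.
apply: almost_periodic_closed => e /exists_inv_le[m me]; exists (K_partial m.+3); split.
  apply: (@almost_periodic_prod _ _ _ _ (fun p N => K_factor N p)) => [p N|p].
    exact: K_factor_01.
  exact: almost_periodic_K_factor.
have He : mean_le (fun _ => e : R) e.
  by exists 0 => n; rewrite addr0 sumr_const_nat subSS subn0 mulr_natr.
apply: mean_le_le He => // N N0; exact: le_trans (K_partial_approx m N0) me.
Qed.

(** * The quotient of K by the totient ratio *)

Lemma KstarE N : Kstar R N = K R N / totient_ratio R N.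
Proof. by rewrite /Kstar /totient_ratio invf_div. Qed.

Lemma Kstar_ge0 N : (0 < N)%N -> 0 <= Kstar R N.
Proof.
move=> N0; have /andP[K0 _] := K_01 N0.
by rewrite KstarE divr_ge0// ltW// totient_ratio_gt0.
Qed.

(** Numerators stay in the unit interval, denominators stay at least [t], and taking the maximum
    with [t] does not increase distances. *)
Lemma div_max_lipschitz (t a b a' b' : R) : 0 < t <= 1 ->
  `|clamp a / Num.max b t - clamp a' / Num.max b' t|
    <= (t ^+ 2)^-1 * (`|a - a'| + `|b - b'|).
Proof.
move=> /andP[t0 t1]; have /andP[c0 c1] := clamp_itv a'.
have mt c : t <= Num.max c t by rewrite le_max lexx orbT.
have m0 c : 0 < Num.max c t by exact: lt_le_trans (mt c).
have -> : clamp a / Num.max b t - clamp a' / Num.max b' t =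
    (clamp a - clamp a') * (Num.max b t)^-1
    + clamp a' * (Num.max b' t - Num.max b t) * (Num.max b t * Num.max b' t)^-1.
  by field; rewrite !gt_eqF.
rewrite (le_trans (ler_normD _ _))// [leRHS]mulrC [leRHS]mulrDl lerD// normrM.
  (* The reciprocal is at most [1 / t], hence at most [1 / t^2] because [t <= 1]; both terms thus
     share one constant. *)
  rewrite ler_pM// ?clamp_lipschitz// gtr0_norm ?invr_gt0//.
  rewrite lef_pV2 ?posrE ?exprn_gt0// (le_trans _ (mt b))//.
  by rewrite expr2 ler_piMl// ltW.
rewrite ler_pM//; last first.
  rewrite gtr0_norm ?invr_gt0 ?mulr_gt0//.
  by rewrite lef_pV2 ?posrE ?exprn_gt0 ?mulr_gt0// expr2 ler_pM// ltW.
rewrite normrM (ger0_norm c0) (le_trans (ler_piMl _ c1))//.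
rewrite /Num.max; case: ifPn; case: ifPn; rewrite ?(distrC b b') -?leNgt => h1 h2 //.
all: rewrite ?subrr ?normr0//.
- by rewrite [leLHS]distrC [leRHS]distrC !ger0_norm; lra.
- by rewrite !ger0_norm; lra.
Qed.

Lemma almost_periodic_ramp_Kstar u v : u < v ->
  almost_periodic (fun N => ramp u v (Kstar R N)).
Proof.
move=> uv; apply: almost_periodic_closed => e e0.
have [m me] : exists m : nat, m.+1%:R^-1 <= e / 2 by apply: exists_inv_le; lra.
(* K / totient_ratio is not Lipschitz in the two factors near 0, hence the
   cutoff t, which changes the value only when large_divisor_sum exceeds 1/2. *)
pose t : R := (2 ^+ m.+2)^-1 / 2.
have t01 : 0 < t <= 1.
  rewrite divr_gt0 ?invr_gt0 ?exprn_gt0//= ler_pdivrMr//.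
  have : (2 ^+ m.+2)^-1 <= 1 :> R by rewrite invf_le1 ?exprn_gt0// exprn_ege1//; lra.
  lra.
exists (fun N => ramp u v (clamp (K R N) / Num.max (totient_ratio R N) t)); split.
  apply: (@almost_periodic_lipschitz2 R (fun a b => ramp u v (clamp a / Num.max b t))
    ((v - u)^-1 * (t ^+ 2)^-1)).
  - by have /andP[t0 _] := t01; rewrite mulr_gt0 ?invr_gt0 ?exprn_gt0; lra.
  - move=> a b a' b'; rewrite (le_trans (ramp_lipschitz _ _ uv))// -mulrA.
    by rewrite ler_wpM2l ?div_max_lipschitz// invr_ge0; lra.
  - exact: almost_periodic_K.
  - exact: almost_periodic_totient_ratio.
(* As in Markov's inequality: where [large_divisor_sum] exceeds 1/2, the two ramp values differ by
   at most 1, less than twice that sum; elsewhere they coincide. *)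
have := mean_leZ (ler0n _ 2) (mean_le_large_divisor_sum R m).
apply: mean_le_le => [N N0|]; last by rewrite mulrC -ler_pdivlMr.
have [S2|S2] := lerP (large_divisor_sum R m.+2 N) 2^-1.
  have /max_idPl-> := totient_ratio_ge N0 S2.
  rewrite clamp_id ?K_01// -KstarE subrr normr0 mulr_ge0//.
  exact: large_divisor_sum_ge0.
apply: (@le_trans _ _ 1); last lra.
have /andP[? ?] := clamp_itv ((v - Kstar R N) / (v - u)).
have /andP[? ?] := clamp_itv
  ((v - clamp (K R N) / Num.max (totient_ratio R N) t) / (v - u)).
by rewrite /ramp ler_norml; apply/andP; split; lra.
Qed.

(** As [K <= 1], a value above [t^-1] forces the totient ratio below [t], hence [large_divisor_sum]
    above 1/2. So the indicator of [Kstar R N <= t^-1] is at least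
    [1 - 2 * large_divisor_sum R m.+2 N], whose mean is at least [1 - e]. *)
Lemma Kstar_tight (e : R) : 0 < e -> exists T n0,
  forall n, (n0 <= n)%N -> 1 - e <= freq (Kstar R) n T.
Proof.
move=> e0.
have [m me] : exists m : nat, m.+1%:R^-1 <= e / 2 by apply: exists_inv_le; lra.
pose t : R := (2 ^+ m.+2)^-1 / 2.
have t0 : 0 < t by rewrite divr_gt0 ?invr_gt0 ?exprn_gt0.
exists t^-1, 1%N => n n0; have n0' : 0 < n%:R :> R by rewrite ltr0n.
rewrite freqE mulrC ler_pdivlMr//.
apply: (@le_trans _ _ (\sum_(1 <= N < n.+1) (1 - 2 * large_divisor_sum R m.+2 N))).
  rewrite sumrB sumr_const_nat subSS subn0 -mulr_sumr mulrBl mul1r lerD2l lerN2.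
  have := le_trans (mean_large_divisor_sum R m n) (ler_wpM2r (ltW n0') me).
  lra.
rewrite big_nat_cond [leRHS]big_nat_cond; apply: ler_sum => N /andP[/andP[N0 _] _].
have S0 := large_divisor_sum_ge0 R m.+2 N.
have [KN|KN] := lerP (Kstar R N) t^-1; first by rewrite /=; lra.
have [S2|S2] := lerP (large_divisor_sum R m.+2 N) 2^-1; last by rewrite /=; lra.
suff : Kstar R N <= t^-1 by lra.
have /andP[K0 K1] := K_01 N0; have H0 := totient_ratio_gt0 R N0.
rewrite KstarE ler_pdivrMr// (le_trans K1)// mulrC ler_pdivlMr// mul1r.
exact: totient_ratio_ge.
Qed.

End EulerProduct.

Theorem theorem1p4 (R : realType) :
  exists D : R -> R, has_distribution_function (Kstar R) D.
Proof.
apply: exists_distribution_function.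
- exact: almost_periodic_ramp_Kstar.
- exact: Kstar_ge0.
- exact: Kstar_tight.
Qed.
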